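(* Every maximalized proof in $\mathcal{G}$ of degree greater than $0$ of a sequent can be reduced to a proof of the same sequent of lower degree.
   Context: Formulae are built from propositional variables and $\bot$ with the binary connectives $\wedge,\vee,\rightarrow$. Sequents have the form $\Gamma \vdash C$, $\Gamma$ a finite (possibly empty) sequence of formulae, $C$ a formula. The system $\mathcal{G}$ has axioms $A \vdash A$ and $\bot \vdash A$ and rules: (C) from $\Delta, A, B, \Gamma \vdash C$ infer $\Delta, B, A, \Gamma \vdash C$; (W) from $\Theta, A, A, \Gamma \vdash C$ infer $\Theta, A, \Gamma \vdash C$; (K) from $\Theta, \Gamma \vdash C$ infer $\Theta, A, \Gamma \vdash C$; (cut) from $\Delta \vdash A$ and $\Theta, A, \Gamma \vdash C$ infer $\Theta, \Delta, \Gamma \vdash C$ ($A$ is the cut formula); ($\wedge$L) from $\Theta, A, \Gamma \vdash C$ (resp. $\Theta, B, \Gamma \vdash C$) infer $\Theta, A\wedge B, \Gamma \vdash C$; ($\wedge$R) from $\Gamma \vdash A$ and $\Gamma \vdash B$ infer $\Gamma \vdash A \wedge B$; ($\vee$L) from $\Theta, A, \Gamma \vdash C$ and $\Theta, B, \Gamma \vdash C$ infer $\Theta, A \vee B, \Gamma \vdash C$; ($\vee$R) from $\Gamma \vdash A$ (resp. $\Gamma \vdash B$) infer $\Gamma \vdash A \vee B$; ($\rightarrow$L) from $\Delta \vdash A$ and $\Theta, B, \Gamma \vdash C$ infer $\Theta, \Delta, A \rightarrow B, \Gamma \vdash C$; ($\rightarrow$R) from $A, \Gamma \vdash B$ infer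 $\Gamma \vdash A \rightarrow B$. The degree of a cut is the number of binary connectives in its cut formula; the degree of a proof is the maximal degree of its cuts (0 if none). A cut has rank 2 iff the occurrence of the cut formula in each premise is newly introduced by the last inference of the subproof ending in that premise (in the left premise: the succedent of an axiom or the principal formula of ($\wedge$R), ($\vee$R), ($\rightarrow$R); in the right premise: a formula of an axiom, the formula added by (K), or the principal formula of ($\wedge$L), ($\vee$L), ($\rightarrow$L)). A cut is maximal iff it has rank 2 and neither of its premises is an axiom. A proof is maximalized iff all cuts in it are maximal. *)

(* Defs.v *)
From mathcomp Require Import all_boot.

Set Implicit Arguments.
Unset Strict Implicit.
Unset Printing Implicit Defensive.

Inductive formula : Type :=
| Var of nat
| Bot
| And of formula & formula
| Or of formula & formula
| Imp of formula & formula.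

Fixpoint connectives (A : formula) : nat :=
  match A with
  | Var _ | Bot => 0
  | And B D | Or B D | Imp B D => (connectives B + connectives D).+1
  end.

(* [proof Gamma C] is the type of proof trees with end-sequent Gamma |- C; it
   lives in Type so that degrees and cuts of a given proof can be computed. *)
Inductive proof : seq formula -> formula -> Type :=
| AxId A : proof [:: A] A
| AxBot A : proof [:: Bot] A
| Exch Delta A B Gamma C :
    proof (Delta ++ A :: B :: Gamma) C -> proof (Delta ++ B :: A :: Gamma) C
| Contr Theta A Gamma C :
    proof (Theta ++ A :: A :: Gamma) C -> proof (Theta ++ A :: Gamma) C
| Weak Theta A Gamma C :
    proof (Theta ++ Gamma) C -> proof (Theta ++ A :: Gamma) C
| Cut Delta A Theta Gamma C :
    proof Delta A -> proof (Theta ++ A :: Gamma) C ->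
    proof (Theta ++ Delta ++ Gamma) C
| AndL1 Theta A B Gamma C :
    proof (Theta ++ A :: Gamma) C -> proof (Theta ++ And A B :: Gamma) C
| AndL2 Theta A B Gamma C :
    proof (Theta ++ B :: Gamma) C -> proof (Theta ++ And A B :: Gamma) C
| AndR Gamma A B :
    proof Gamma A -> proof Gamma B -> proof Gamma (And A B)
| OrL Theta A B Gamma C :
    proof (Theta ++ A :: Gamma) C -> proof (Theta ++ B :: Gamma) C ->
    proof (Theta ++ Or A B :: Gamma) C
| OrR1 Gamma A B : proof Gamma A -> proof Gamma (Or A B)
| OrR2 Gamma A B : proof Gamma B -> proof Gamma (Or A B)
| ImpL Delta A Theta B Gamma C :
    proof Delta A -> proof (Theta ++ B :: Gamma) C ->
    proof (Theta ++ Delta ++ Imp A B :: Gamma) C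
| ImpR A Gamma B : proof (A :: Gamma) B -> proof Gamma (Imp A B).

Fixpoint degree Gamma C (p : proof Gamma C) : nat :=
  match p with
  | AxId _ | AxBot _ => 0
  | Exch _ _ _ _ _ q => degree q
  | Contr _ _ _ _ q => degree q
  | Weak _ _ _ _ q => degree q
  | Cut _ A _ _ _ q r => maxn (connectives A) (maxn (degree q) (degree r))
  | AndL1 _ _ _ _ _ q => degree q
  | AndL2 _ _ _ _ _ q => degree q
  | AndR _ _ _ q r => maxn (degree q) (degree r)
  | OrL _ _ _ _ _ q r => maxn (degree q) (degree r)
  | OrR1 _ _ _ q => degree q
  | OrR2 _ _ _ q => degree q
  | ImpL _ _ _ _ _ _ q r => maxn (degree q) (degree r)
  | ImpR _ _ _ q => degree q
  end.

Definition is_axiom Gamma C (p : proof Gamma C) : bool :=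
  match p with
  | AxId _ | AxBot _ => true
  | _ => false
  end.

Definition introduces_succedent Gamma C (p : proof Gamma C) : bool :=
  match p with
  | AxId _ | AxBot _ => true
  | AndR _ _ _ _ _ | OrR1 _ _ _ _ | OrR2 _ _ _ _ | ImpR _ _ _ _ => true
  | _ => false
  end.

(* Occurrences in an antecedent are identified by their position, counted from
   0: the occurrence number [i] in the antecedent of the end-sequent is newly
   introduced by the last inference. *)
Definition introduces_antecedent Gamma C (i : nat) (p : proof Gamma C) : bool :=
  match p with
  | AxId _ | AxBot _ => i == 0
  | Weak Theta _ _ _ _ => i == size Theta
  | AndL1 Theta _ _ _ _ _ => i == size Theta
  | AndL2 Theta _ _ _ _ _ => i == size Theta
  | OrL Theta _ _ _ _ _ _ => i == size Theta
  | ImpL Delta _ Theta _ _ _ _ _ => i == size Theta + size Delta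
  | _ => false
  end.

(* Rank and maximality of the cut [Cut q r] with premises [q] and [r]; the cut
   formula sits at position [size Theta] in the antecedent of [r]. *)
Definition rank2_cut Delta A Theta Gamma C
    (q : proof Delta A) (r : proof (Theta ++ A :: Gamma) C) : bool :=
  introduces_succedent q && introduces_antecedent (size Theta) r.

Definition maximal_cut Delta A Theta Gamma C
    (q : proof Delta A) (r : proof (Theta ++ A :: Gamma) C) : bool :=
  [&& rank2_cut q r, ~~ is_axiom q & ~~ is_axiom r].

Fixpoint maximalized Gamma C (p : proof Gamma C) : bool :=
  match p with
  | AxId _ | AxBot _ => true
  | Exch _ _ _ _ _ q => maximalized q
  | Contr _ _ _ _ q => maximalized q
  | Weak _ _ _ _ q => maximalized q
  | Cut _ _ _ _ _ q r => [&& maximal_cut q r, maximalized q & maximalized r]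
  | AndL1 _ _ _ _ _ q => maximalized q
  | AndL2 _ _ _ _ _ q => maximalized q
  | AndR _ _ _ q r => maximalized q && maximalized r
  | OrL _ _ _ _ _ q r => maximalized q && maximalized r
  | OrR1 _ _ _ q => maximalized q
  | OrR2 _ _ _ q => maximalized q
  | ImpL _ _ _ _ _ _ q r => maximalized q && maximalized r
  | ImpR _ _ _ q => maximalized q
  end.

(* Main.v *)
Require Import Defs.
From mathcomp Require Import all_boot.

(** A maximal cut is a principal cut, so replacing it by cuts on the immediate
    subformulae of its cut formula (or by weakenings, when the cut formula comes
    from (K)) makes the degree of the cut drop.  Doing this for all cuts at once
    requires knowing, besides the reduced proof of each sequent, reduced proofs of
    the premises of its last inference: these do not survive in the reduced
    proof itself, hence the strengthened induction in [maximalized_reducible]. *)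

Definition provable d Gamma C := exists q : proof Gamma C, degree q <= d.

(** Atoms get [False]: outside axioms, no rule introduces them in the succedent. *)
Definition right_premises d Gamma C : Prop :=
  match C with
  | And A B => provable d Gamma A /\ provable d Gamma B
  | Or A B => provable d Gamma A \/ provable d Gamma B
  | Imp A B => provable d (A :: Gamma) B
  | _ => False
  end.

(** For [Imp], the context before [F] mixes those of both premises of the left rule, so its
    splitting point is part of the data. *)
Definition left_premises d Theta F Gamma C : Prop :=
  match F with
  | And A B =>
      provable d (Theta ++ A :: Gamma) C \/ provable d (Theta ++ B :: Gamma) C
  | Or A B =>
      provable d (Theta ++ A :: Gamma) C /\ provable d (Theta ++ B :: Gamma) C
  | Imp A B => exists Theta' Delta,
      [/\ Theta = Theta' ++ Delta, provable d Delta A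
        & provable d (Theta' ++ B :: Gamma) C]
  | _ => False
  end.

Lemma provable_cut d Delta A Theta Gamma C :
  connectives A <= d -> provable d Delta A ->
  provable d (Theta ++ A :: Gamma) C -> provable d (Theta ++ Delta ++ Gamma) C.
Proof.
by move=> hA [q hq] [r hr]; exists (Cut q r); rewrite /= !geq_max hA hq hr.
Qed.

Lemma provable_weak d Theta Delta Gamma C :
  provable d (Theta ++ Gamma) C -> provable d (Theta ++ Delta ++ Gamma) C.
Proof.
by move=> h; elim: Delta => //= A Delta [q hq]; exists (Weak A q).
Qed.

Lemma principal_cut d Delta A Theta Gamma C :
  connectives A <= d.+1 -> right_premises d Delta A ->
  left_premises d Theta A Gamma C -> provable d (Theta ++ Delta ++ Gamma) C.
Proof.
case: A => [n||A B|A B|A B] //=; rewrite ltnS => hAB;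
  have hA := leq_trans (leq_addr _ _) hAB;
  have hB := leq_trans (leq_addl _ _) hAB.
- by move=> [qA qB] [rA|rB]; [apply: provable_cut qA rA | apply: provable_cut qB rB].
- by move=> [qA|qB] [rA rB]; [apply: provable_cut qA rA | apply: provable_cut qB rB].
- move=> qB [Theta' [Delta' [-> qA rB]]].
  (* Two nested cuts: first on [A], with empty left context, giving [B] from [Delta' ++ Delta]; then
     on [B]. *)
  have qB' := provable_cut _ _ _ [::] _ _ hA qA qB.
  by have := provable_cut _ _ _ _ _ _ hB qB' rB; rewrite -!catA.
Qed.

(** Converts equality of numerical positions into equality of the occurrences and their contexts. *)
Lemma cat_cons_inj (T : Type) (s1 s2 t1 t2 : seq T) (x y : T) :
  size s1 = size t1 -> s1 ++ x :: s2 = t1 ++ y :: t2 ->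
  [/\ s1 = t1, x = y & s2 = t2].
Proof.
elim: s1 t1 => [|a s1 IH] [|b t1] //= => [_ [] //|[hs] [->]].
by case/(IH _ hs) => -> -> ->.
Qed.

(** In the last clause, the first disjunct accounts for (K), whose premise lacks [F]. Axioms are
    excluded because they have no premises. *)
Lemma maximalized_reducible d Gamma C (p : proof Gamma C) :
  maximalized p -> degree p <= d.+1 ->
  [/\ provable d Gamma C,
      introduces_succedent p && ~~ is_axiom p -> right_premises d Gamma C
    & forall Theta F Gamma', Gamma = Theta ++ F :: Gamma' ->
      introduces_antecedent (size Theta) p && ~~ is_axiom p ->
      provable d (Theta ++ Gamma') C \/ left_premises d Theta F Gamma' C].
Proof.
elim: p => {Gamma C} /=.
- by move=> A _ _; split=> // [|T F G _]; [exists (AxId A) | rewrite andbF].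
- by move=> A _ _; split=> // [|T F G _]; [exists (AxBot A) | rewrite andbF].
- move=> Delta A B Gamma C q IH mq dq; have [[q' hq'] _ _] := IH mq dq.
  by split=> //; exists (Exch q').
- move=> Theta A Gamma C q IH mq dq; have [[q' hq'] _ _] := IH mq dq.
  by split=> //; exists (Contr q').
- move=> Theta A Gamma C q IH mq dq; have [[q' hq'] _ _] := IH mq dq.
  split=> // [|T F G e]; first by exists (Weak A q').
  rewrite andbT => /eqP /esym hs; have [<- _ <-] := cat_cons_inj _ _ _ _ _ _ _ hs e.
  by left; exists q'.
- move=> Delta A Theta Gamma C q IHq r IHr.
  move=> /and3P[/and3P[/andP[sq ar] nq nr] mq mr].
  rewrite !geq_max => /and3P[dA dq dr].
  have [_ /(_ (introT andP (conj sq nq))) hq _] := IHq mq dq.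
  have [_ _ /(_ _ _ _ erefl (introT andP (conj ar nr))) hr] := IHr mr dr.
  (* If (K) introduced the cut formula, the left premise is dropped and [Delta] is restored by
     weakening; otherwise the cut is principal on both sides. *)
  split=> //; case: hr => [|hr]; first exact: provable_weak.
  exact: principal_cut dA hq hr.
- move=> Theta A B Gamma C q IH mq dq; have [[q' hq'] _ _] := IH mq dq.
  split=> // [|T F G e]; first by exists (AndL1 B q').
  rewrite andbT => /eqP /esym hs; have [<- <- <-] := cat_cons_inj _ _ _ _ _ _ _ hs e.
  by right; left; exists q'.
- move=> Theta A B Gamma C q IH mq dq; have [[q' hq'] _ _] := IH mq dq.
  split=> // [|T F G e]; first by exists (AndL2 A q').
  rewrite andbT => /eqP /esym hs; have [<- <- <-] := cat_cons_inj _ _ _ _ _ _ _ hs e.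
  by right; right; exists q'.
- move=> Gamma A B q IHq r IHr /andP[mq mr]; rewrite geq_max => /andP[dq dr].
  have [[q' hq'] _ _] := IHq mq dq; have [[r' hr'] _ _] := IHr mr dr.
  split=> //; first by exists (AndR q' r'); rewrite /= geq_max hq' hr'.
  by split; [exists q' | exists r'].
- move=> Theta A B Gamma C q IHq r IHr /andP[mq mr].
  rewrite geq_max => /andP[dq dr].
  have [[q' hq'] _ _] := IHq mq dq; have [[r' hr'] _ _] := IHr mr dr.
  split=> // [|T F G e]; first by exists (OrL q' r'); rewrite /= geq_max hq' hr'.
  rewrite andbT => /eqP /esym hs; have [<- <- <-] := cat_cons_inj _ _ _ _ _ _ _ hs e.
  by right; split; [exists q' | exists r'].
- move=> Gamma A B q IH mq dq; have [[q' hq'] _ _] := IH mq dq.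
  by split=> //; [exists (OrR1 B q') | left; exists q'].
- move=> Gamma A B q IH mq dq; have [[q' hq'] _ _] := IH mq dq.
  by split=> //; [exists (OrR2 A q') | right; exists q'].
- move=> Delta A Theta B Gamma C q IHq r IHr /andP[mq mr].
  rewrite geq_max => /andP[dq dr].
  have [[q' hq'] _ _] := IHq mq dq; have [[r' hr'] _ _] := IHr mr dr.
  split=> // [|T F G].
    by exists (ImpL q' r'); rewrite /= geq_max hq' hr'.
  (* The principal implication stands after both contexts, so [Theta ++ Delta] is taken as its left
     context. *)
  rewrite catA andbT -size_cat => e /eqP /esym hs.
  have [<- <- <-] := cat_cons_inj _ _ _ _ _ _ _ hs e.
  by right; exists Theta, Delta; split=> //; [exists q' | exists r'].
- move=> A Gamma B q IH mq dq; have [[q' hq'] _ _] := IH mq dq.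
  by split=> //; [exists (ImpR q') | exists q'].
Qed.

Theorem theorem6p2 (Gamma : seq formula) (C : formula) (p : proof Gamma C) :
  maximalized p -> 0 < degree p ->
  exists q : proof Gamma C, degree q < degree p.
Proof.
(* With the degree written [d.+1], the bound [d] is the required strict decrease. *)
move=> mp; case dp: (degree p) => [//|d] _.
by have [|[q hq] _ _] := maximalized_reducible d _ _ p mp; [rewrite dp | exists q].
Qed.
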